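(* Let $n\ge1$, $d\ge0$, let $D=2d+n$, and assume that $\mu(D)=n$. Then the up Kameko map $\upsilon_n$ induces a natural isomorphism $$\upsilon_n^{\mathrm{rel}}:\mathcal C_d(n)\xrightarrow{\ \cong\ }\mathcal C_D(n).$$
   Context: $P(n)=\mathbf F_2[x_1,\dots,x_n]$, $|x_i|=1$; the total Steenrod square $\mathrm{Sq}=\sum_r\mathrm{Sq}^r$ is the algebra endomorphism with $\mathrm{Sq}(x_i)=x_i+x_i^2$. $\Sigma_n$ permutes the variables and $B(n)=P(n)^{\Sigma_n}$. For $M=P(n)$ or $B(n)$, $\mathcal H^d(M)=\sum_{r>0}\mathrm{Sq}^r(M^{d-r})$ and $Q_d(M)=M^d/\mathcal H^d(M)$. The relative cohit space is $\mathcal C_d(n)=\ker\big(Q_d(B(n))\to Q_d(P(n))\big)=\big(B^d(n)\cap\mathcal H^d(P(n))\big)/\mathcal H^d(B(n))$. The up Kameko map is $\upsilon_n:P^d(n)\to P^{2d+n}(n)$, $\upsilon_n(f)=x_1\cdots x_n\,f^2$; it maps $B^d(n)$ into $B^{2d+n}(n)$. For $d>0$, $\mu(d)$ is the least $s$ such that $d=\sum_{i=1}^s(2^{r_i}-1)$ with all $r_i>0$; $\mu(0)=0$. Known background (due to Kameko and Walker–Wood): if $\mu(2d+n)=n$, then $\upsilon_n$ induces isomorphisms $Q_d(P(n))\cong Q_{2d+n}(P(n))$ and $Q_d(B(n))\cong Q_{2d+n}(B(n))$. *)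

(* Defs.v *)
From HB Require Import structures.
From mathcomp Require Import all_boot all_order all_algebra.
From mathcomp Require Import fingroup perm generic_quotient ring_quotient.
From mathcomp Require Import boolp.
From mathcomp Require Import mpoly.

Set Implicit Arguments.
Unset Strict Implicit.
Unset Printing Implicit Defensive.

Import GRing.Theory.
Local Open Scope ring_scope.
Local Open Scope quotient_scope.

Section QuotientModule.
Context (K : pzRingType) (V : lmodType K) (U : submodClosed V).

(* GRing.SubmodClosed does not inherit closure under opposite, which the
   quotient of the additive group needs. *)
Definition submod_zmod : zmodClosed V :=
  HB.pack (U : {pred V})
    (GRing.isSubmodClosed.Build K V (U : {pred V}) (submodClosedP U)).

Definition lquot := @Quotient.quot V submod_zmod.

HB.instance Definition _ := GRing.Zmodule.on lquot.

Definition lclass (v : V) : lquot := \pi_(@Quotient.quot V submod_zmod) v.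
Definition lrepr (x : lquot) : V := repr (x : @Quotient.quot V submod_zmod).

Lemma lreprK x : lclass (lrepr x) = x.
Proof. exact: (@reprK _ (@Quotient.quot V submod_zmod)). Qed.

Lemma eq_lclass v w : (lclass v == lclass w) = (v - w \in U).
Proof. exact: (esym (@Quotient.idealrBE V submod_zmod v w)). Qed.

Lemma lrepr_lclass v : lrepr (lclass v) - v \in U.
Proof. by rewrite -eq_lclass lreprK. Qed.

Lemma lclass_is_zmod_morphism : zmod_morphism lclass.
Proof. by move=> v w; rewrite /lclass raddfB. Qed.

HB.instance Definition _ :=
  GRing.isZmodMorphism.Build V lquot lclass lclass_is_zmod_morphism.

Definition lquot_scale (a : K) (x : lquot) : lquot := lclass (a *: lrepr x).

Lemma lquot_scaleE a v : lquot_scale a (lclass v) = lclass (a *: v).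
Proof. by apply/eqP; rewrite eq_lclass -scalerBr rpredZ ?lrepr_lclass. Qed.

Lemma lquot_scalerA a b x :
  lquot_scale a (lquot_scale b x) = lquot_scale (a * b) x.
Proof. by rewrite -[x]lreprK !lquot_scaleE scalerA. Qed.

Lemma lquot_scale1r : left_id 1 lquot_scale.
Proof. by move=> x; rewrite -[x]lreprK lquot_scaleE scale1r. Qed.

Lemma lquot_scalerDr : right_distributive lquot_scale +%R.
Proof.
move=> a x y; rewrite -[x]lreprK -[y]lreprK -raddfD !lquot_scaleE -raddfD.
by rewrite scalerDr.
Qed.

Lemma lquot_scalerDl x : {morph lquot_scale^~ x : a b / a + b}.
Proof. by move=> a b; rewrite -[x]lreprK !lquot_scaleE scalerDl raddfD. Qed.

HB.instance Definition _ := GRing.Zmodule_isLmodule.Build K lquot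
  lquot_scalerA lquot_scale1r lquot_scalerDr lquot_scalerDl.

Lemma lclass_is_scalable : scalable lclass.
Proof. by move=> a v; rewrite -lquot_scaleE. Qed.

HB.instance Definition _ :=
  GRing.isScalable.Build K V lquot *:%R lclass lclass_is_scalable.

End QuotientModule.

Section Steenrod.
Context (n : nat).
Local Notation P := {mpoly 'F_2[n]}.

Definition Sq_total (f : P) : P := f \mPo [tuple 'X_i + 'X_i ^+ 2 | i < n].

(* On a form of degree e, Sq^r is the component of degree e + r of the total
   square; this is extended linearly to inhomogeneous polynomials. *)
Definition Sq (r : nat) (f : P) : P :=
  \sum_(e < msize f) pihomog mdeg (e + r) (Sq_total (pihomog mdeg e f)).

Lemma Sq_wide (k r : nat) (f : P) : (msize f <= k)%N ->
  Sq r f = \sum_(e < k) pihomog mdeg (e + r) (Sq_total (pihomog mdeg e f)).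
Proof.
pose F e := pihomog mdeg (e + r) (Sq_total (pihomog mdeg e f)).
move=> le_fk; rewrite /Sq (big_ord_widen k F) // big_mkcond /=.
apply: eq_bigr => e _; case: ltnP => // le_fe.
rewrite /pihomog [X in Sq_total X]big_seq_cond [X in Sq_total X]big1; last first.
  move=> m /andP[/msize_mdeg_lt m_lt /eqP dm].
  by move: (leq_trans m_lt le_fe); rewrite dm ltnn.
by rewrite /Sq_total comp_mpoly0 msupp0 big_nil.
Qed.

Lemma Sq_is_linear r : linear (Sq r).
Proof.
move=> a f g; pose k := maxn (msize (a *: f + g)) (maxn (msize f) (msize g)).
rewrite !(@Sq_wide k) ?leq_max ?leqnn ?orbT // scaler_sumr -big_split /=.
apply: eq_bigr => e _.
rewrite /Sq_total pihomog_is_linear comp_mpolyD comp_mpolyZ.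
by rewrite pihomog_is_linear.
Qed.

HB.instance Definition _ r :=
  GRing.isLinear.Build 'F_2 P P *:%R (Sq r) (Sq_is_linear r).

Lemma Sq_homogE r e (f : P) : f \is e.-homog ->
  Sq r f = pihomog mdeg (e + r) (Sq_total f).
Proof.
move=> df; pose k := maxn (msize f) e.+1.
have lt_ek : (e < k)%N by rewrite leq_max leqnn orbT.
rewrite (@Sq_wide k) ?leq_max ?leqnn // (bigD1 (Ordinal lt_ek)) //=.
rewrite (pihomog_dE df) big1 ?addr0 // => i ne_ie.
rewrite (pihomog_ne0 _ df) 1?eq_sym //.
by rewrite /Sq_total comp_mpoly0 pihomog0.
Qed.

Definition kameko (f : P) : P := (\prod_(i < n) 'X_i) * f ^+ 2.

Definition all_pred : {pred P} := predT.

Fact all_submod_closed : submod_closed all_pred.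
Proof. by []. Qed.

HB.instance Definition _ :=
  GRing.isSubmodClosed.Build 'F_2 P all_pred all_submod_closed.

Definition sym_pred : {pred P} := fun f => f \is symmetric.

Fact sym_pred_submod_closed : submod_closed sym_pred.
Proof. exact: sym_submod_closed. Qed.

HB.instance Definition _ :=
  GRing.isSubmodClosed.Build 'F_2 P sym_pred sym_pred_submod_closed.

End Steenrod.

Section Cohits.
Context (n : nat) (M : submodClosed {mpoly 'F_2[n]}) (d : nat).
Local Notation P := {mpoly 'F_2[n]}.

Definition grade_pred : {pred P} := fun f => (f \in M) && (f \is d.-homog).

Fact grade_submod_closed : submod_closed grade_pred.
Proof.
split=> [|a f g]; first by apply/andP; split; exact: rpred0.
move=> /andP[Mf df] /andP[Mg dg]; apply/andP.
by split; apply: rpredD => //; apply: rpredZ.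
Qed.

HB.instance Definition _ :=
  GRing.isSubmodClosed.Build 'F_2 P grade_pred grade_submod_closed.

Record grade := Grade { poly_of_grade :> P; _ : poly_of_grade \in grade_pred }.

HB.instance Definition _ := [isSub for poly_of_grade].
HB.instance Definition _ := [Choice of grade by <:].
HB.instance Definition _ := [SubChoice_isSubLmodule of grade by <:].

(* H^d(M); the terms of the sum with r > d vanish, as M^(d-r) = 0. *)
Definition hit (f : P) : Prop :=
  exists g : nat -> P,
    (forall r, (1 <= r <= d)%N -> g r \in M /\ g r \is (d - r).-homog) /\
    f = \sum_(1 <= r < d.+1) Sq r (g r).

Definition hit_pred : {pred grade} := fun f => `[< hit (val f) >].

Fact hit_submod_closed : submod_closed hit_pred.
Proof.
split=> [|a f g].
  apply/asboolP; exists (fun=> 0); split=> [r _|]; first by rewrite !rpred0.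
  by rewrite big1 // => r _; rewrite linear0.
move=> /asboolP[u [uP fE]] /asboolP[v [vP gE]]; apply/asboolP.
exists (fun r => a *: u r + v r); split=> [r /[dup] /uP[? ?] /vP[? ?]|].
  by split; apply: rpredD => //; apply: rpredZ.
rewrite linearP /= fE gE scaler_sumr -big_split /=.
by apply: eq_bigr => r _; rewrite linearP.
Qed.

HB.instance Definition _ :=
  GRing.isSubmodClosed.Build 'F_2 grade hit_pred hit_submod_closed.

Definition cohit := @lquot 'F_2 grade hit_pred.

HB.instance Definition _ := GRing.Lmodule.on cohit.

Definition cohit_class (f : grade) : cohit := @lclass 'F_2 grade hit_pred f.

End Cohits.

Section Relative.
Context (n : nat).
Local Notation P := {mpoly 'F_2[n]}.
Local Notation Pn := (@all_pred n : submodClosed P).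
Local Notation Bn := (@sym_pred n : submodClosed P).

Section Degree.
Context (d : nat).

Definition gradeP := grade Pn d.
Definition gradeB := grade Bn d.
Definition cohitP := cohit Pn d.
Definition cohitB := cohit Bn d.

HB.instance Definition _ := GRing.Lmodule.on cohitP.
HB.instance Definition _ := GRing.Lmodule.on cohitB.

Lemma gradeB_sym (f : gradeB) : val f \is symmetric.
Proof. by case: f => f /= /andP[]. Qed.

Lemma gradeB_homog (f : gradeB) : val f \is d.-homog.
Proof. by case: f => f /= /andP[]. Qed.

Fact gradeBP (f : gradeB) : val f \in grade_pred Pn d.
Proof. exact/andP/(conj _ (gradeB_homog f)). Qed.

Definition inclB (f : gradeB) : gradeP := Grade (gradeBP f).

(* Q_d(B(n)) -> Q_d(P(n)), induced by the inclusion: see cohit_inclE *)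
Definition cohit_incl (x : cohitB) : cohitP := cohit_class (inclB (lrepr x)).

Lemma hit_incl (f : P) : hit Bn d f -> hit Pn d f.
Proof. by case=> g [gP ->]; exists g; split=> // r /gP[]. Qed.

Lemma cohit_inclE (f : gradeB) :
  cohit_incl (cohit_class f) = cohit_class (inclB f).
Proof.
have /asboolP f_hit := @lrepr_lclass 'F_2 _ (@hit_pred n Bn d) f.
by apply/eqP; rewrite eq_lclass; apply/asboolP/(hit_incl f_hit).
Qed.

Lemma cohit_incl_is_linear : linear cohit_incl.
Proof.
move=> a x y; rewrite -[x]lreprK -[y]lreprK -linearP !cohit_inclE -linearP.
by congr lclass; apply: val_inj.
Qed.

HB.instance Definition _ :=
  GRing.isLinear.Build 'F_2 cohitB cohitP *:%R cohit_incl cohit_incl_is_linear.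

Definition rel_pred : {pred cohitB} := fun x => cohit_incl x == 0.

Lemma rel_predP (f : gradeB) :
  reflect (hit Pn d (val f)) (cohit_class f \in rel_pred).
Proof.
rewrite /rel_pred unfold_in cohit_inclE.
rewrite -(raddf0 (@lclass 'F_2 _ (@hit_pred n Pn d))) eq_lclass subr0.
exact: asboolP.
Qed.

Fact rel_submod_closed : submod_closed rel_pred.
Proof.
split=> [|a x y]; rewrite !unfold_in; first by rewrite linear0.
by move=> /eqP x0 /eqP y0; rewrite linearP /= x0 y0 scaler0 addr0.
Qed.

HB.instance Definition _ :=
  GRing.isSubmodClosed.Build 'F_2 cohitB rel_pred rel_submod_closed.

(* C_d(n) as a kernel; by rel_predP its elements are the classes of the
   f in B^d(n) with f in H^d(P(n)). *)
Record rel_cohit :=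
  RelCohit { cohit_of_rel :> cohitB; _ : cohit_of_rel \in rel_pred }.

HB.instance Definition _ := [isSub for cohit_of_rel].
HB.instance Definition _ := [Choice of rel_cohit by <:].
HB.instance Definition _ := [SubChoice_isSubLmodule of rel_cohit by <:].

End Degree.

Fact kameko_gradeB d (f : gradeB d) :
  kameko (val f) \in grade_pred Bn (2 * d + n).
Proof.
apply/andP; split.
  apply: rpredM; last exact/rpredX/gradeB_sym.
  apply/issymP => s; rewrite rmorph_prod /= [RHS](reindex_inj (@perm_inj _ s)).
  apply: eq_bigr => i _; rewrite msymX; congr mpolyX; apply/mnmP => j.
  by rewrite !mnmE (canF_eq (permK s)).
rewrite addnC mulnC; apply: dhomogM; last exact/dhomogMn/gradeB_homog.
rewrite mprodXE dhomogX; apply/eqP.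
transitivity (\sum_(i < n) mdeg U_(i))%N.
  exact: (big_morph mdeg (@mdegD n) (@mdeg0 n)).
by rewrite (eq_bigr (fun=> 1%N)) ?sum1_card ?card_ord // => i _; exact: mdeg1.
Qed.

Definition kamekoB d (f : gradeB d) : gradeB (2 * d + n) :=
  Grade (kameko_gradeB f).

End Relative.

Fact mu_exists (d : nat) : exists s, `[< exists r : s.-tuple nat,
  all (leq 1) r /\ d = (\sum_(k <- r) (2 ^ k - 1))%N >].
Proof.
exists d; apply/asboolP; exists [tuple of nseq d 1%N].
rewrite all_nseq orbT; split=> //.
by rewrite big_nseq_cond /= iter_addn_0 mul1n.
Qed.

Definition mu (d : nat) : nat := ex_minn (mu_exists d).

(* Main.v *)
Require Import Defs.
From HB Require Import structures.
From mathcomp Require Import all_boot all_order all_algebra.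
From mathcomp Require Import fingroup perm zify boolp.
From mathcomp Require Import ssrcomplements mpoly.

Set Implicit Arguments.
Unset Strict Implicit.
Unset Printing Implicit Defensive.

Import GRing.Theory.
Local Open Scope ring_scope.

(* The inverse of the up Kameko map is induced by the down Kameko map, which
   sends [x_1...x_n f^2] to [f] and kills every monomial with an even exponent.
   It commutes with the total square, so it preserves hits, both in [P(n)] and
   in [B(n)]. Everything else follows from one fact: if [mu D = n], a form [f]
   of degree [D] all of whose monomials have an even exponent is hit, by
   elements that are symmetric when [f] is. Let [W] be the linear map sending
   [x^m] to the product of the [xi(x_i)^(m_i mod 2) x_i^(m_i / 2)], with
   [xi(x) = x + x^2 + x^4 + ...]. As [Sq(xi(x)) = x], the form [f] is the
   component of degree [D] of [Sq(W f)]; and [W f] itself has no component of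
   degree [D], as a monomial there would write [D] as a sum of fewer than [n]
   numbers [2^r - 1]. Hence [f = sum_(r > 0) Sq^r (W f)_(D - r)]. The total
   square, both Kameko maps and [W] all act on monomials variable by variable,
   hence commute with permutations, and identities between them reduce to one
   variable. *)

(** * Linear operators acting variable by variable *)

Section TensorPower.
Context (R : comNzRingType) (n : nat).
Implicit Types (u v : nat -> {poly R}) (p : 'I_n -> {poly R}).
Implicit Types (f : {mpoly R[n]}) (m : 'X_{1..n}).

Definition tensor p : {mpoly R[n]} :=
  \prod_(i < n) (map_poly (@mpolyC n R) (p i)).['X_i].

(** A common bound [k] gives all factors the same index type, so the product of sums expands over
    functions. *)
Lemma tensorE k p : (forall i, size (p i) <= k)%N ->
  tensor p = \sum_(a : {ffun 'I_n -> 'I_k})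
    (\prod_(i < n) (p i)`_(a i)) *: 'X_[[multinom a i : nat | i < n]].
Proof.
move=> le_pk; pose F i (j : 'I_k) : {mpoly R[n]} := (p i)`_j *: 'X_i ^+ j.
transitivity (\prod_(i < n) \sum_(j < k) F i j).
  apply: eq_bigr => i _; rewrite (@horner_coef_wide _ k); last first.
    exact: leq_trans (size_poly _ _) (le_pk i).
  by apply: eq_bigr => j _; rewrite coef_map mul_mpolyC.
rewrite bigA_distr_bigA; apply: eq_bigr => a _ /=.
rewrite scaler_prod mpolyXE_id; congr (_ *: _).
by apply: eq_bigr => i _; rewrite mnmE.
Qed.

Lemma mcoeff_tensor p m : (tensor p)@_m = \prod_(i < n) (p i)`_(m i).
Proof.
pose k := maxn (\max_i size (p i)) (\max_i (m i).+1).
have le_pk i : (size (p i) <= k)%N by rewrite leq_max (leq_bigmax i).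
have lt_mk i : (m i < k)%N.
  by rewrite leq_max (leq_bigmax (F := fun i => (m i).+1) i) orbT.
rewrite (tensorE le_pk) raddf_sum /=.
rewrite (bigD1 [ffun i => Ordinal (lt_mk i)]) //= mcoeffZ mcoeffX.
have -> : [multinom [ffun i => Ordinal (lt_mk i)] i : nat | i < n] = m.
  by apply/mnmP => i; rewrite mnmE ffunE.
rewrite eqxx mulr1 [X in _ + X]big1 ?addr0 => [|a ne_a].
  by apply: eq_bigr => i _; rewrite ffunE.
rewrite mcoeffZ mcoeffX; case: eqP => [am|_]; last by rewrite mulr0.
case/eqP: ne_a; apply/ffunP => i; apply: val_inj.
by rewrite ffunE /= -am mnmE.
Qed.

(** The [n]-th tensor power of the linear map sending ['X^k] to [u k]; [u] need not be
    multiplicative. *)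
Definition textend u f : {mpoly R[n]} :=
  \sum_(m <- msupp f) f@_m *: tensor (fun i => u (m i)).

Lemma textend_wide k u f : (msize f <= k)%N ->
  textend u f = \sum_(m : 'X_{1..n < k}) f@_m *: tensor (fun i => u (m i)).
Proof.
move=> le_fk; pose I : subFinType _ := 'X_{1..n < k}.
rewrite /textend (big_mksub I) //=; first last.
- by move=> m /msize_mdeg_lt /leq_trans; apply.
- by rewrite msupp_uniq.
by rewrite big_rmcond //= => m; move/memN_msupp_eq0 ->; rewrite scale0r.
Qed.

Lemma textend_is_linear u : linear (textend u).
Proof.
move=> c f g; pose k := maxn (msize (c *: f + g)) (maxn (msize f) (msize g)).
rewrite !(@textend_wide k) ?leq_max ?leqnn ?orbT // scaler_sumr -big_split /=.
by apply: eq_bigr => m _; rewrite linearP /= scalerDl scalerA.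
Qed.

HB.instance Definition _ u :=
  GRing.isLinear.Build R {mpoly R[n]} {mpoly R[n]} *:%R (textend u)
    (textend_is_linear u).

Lemma textendX u m : textend u 'X_[m] = tensor (fun i => u (m i)).
Proof. by rewrite /textend msuppX big_seq1 mcoeffX eqxx scale1r. Qed.

Lemma eq_linear_mpolyX (V : lmodType R) (L1 L2 : {linear {mpoly R[n]} -> V}) :
  (forall m, L1 'X_[m] = L2 'X_[m]) -> L1 =1 L2.
Proof.
move=> eqX f; rewrite (mpolyE f) !linear_sum.
by apply: eq_bigr => m _; rewrite !linearZ eqX.
Qed.

Definition uextend u (q : {poly R}) : {poly R} := \sum_(k < size q) q`_k *: u k.

Lemma uextend_wide k u (q : {poly R}) : (size q <= k)%N ->
  uextend u q = \sum_(j < k) q`_j *: u j.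
Proof.
move=> le_qk; rewrite /uextend (big_ord_widen k (fun j => q`_j *: u j)) //.
rewrite big_mkcond /=; apply: eq_bigr => j _; case: ltnP => // le_qj.
by rewrite nth_default // scale0r.
Qed.

Lemma uextendXn u k : uextend u 'X^k = u k.
Proof.
rewrite (@uextend_wide k.+1) ?size_polyXn // (bigD1 ord_max) //= coefXn eqxx.
rewrite scale1r big1 ?addr0 // => j; rewrite coefXn -val_eqE /= => /negPf ->.
by rewrite scale0r.
Qed.

Lemma textend_tensor u p :
  textend u (tensor p) = tensor (fun i => uextend u (p i)).
Proof.
pose k := \max_i size (p i).
have le_pk i : (size (p i) <= k)%N by exact: (leq_bigmax i).
rewrite (tensorE le_pk) linear_sum; apply/mpolyP => m.
rewrite mcoeff_tensor raddf_sum /=.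
under eq_bigr do rewrite linearZ /= mcoeffZ textendX mcoeff_tensor -big_split.
under [RHS]eq_bigr => i _ do rewrite (uextend_wide u (le_pk i)) coef_sum.
rewrite bigA_distr_bigA; apply: eq_bigr => a _ /=; apply: eq_bigr => i _.
by rewrite coefZ mnmE.
Qed.

(** Functoriality of the tensor power: a composite is determined by the composite in one
    variable. *)
Lemma textend_comp u v f :
  textend u (textend v f) = textend (fun k => uextend u (v k)) f.
Proof.
rewrite [textend v f]/textend linear_sum /=; apply: eq_bigr => m _.
by rewrite linearZ /= textend_tensor.
Qed.

Lemma eq_textend u v f : u =1 v -> textend u f = textend v f.
Proof. by move=> /funext ->. Qed.

Lemma textendXn f : textend (fun k => 'X^k) f = f.
Proof.
rewrite [RHS]mpolyE; apply: eq_bigr => m _; congr (_ *: _).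
apply/mpolyP => m'; rewrite mcoeff_tensor mcoeffX.
under eq_bigr do rewrite coefXn.
case: eqP => [->|/eqP ne_m]; first by rewrite big1 // => i _; rewrite eqxx.
have [/forallP eq_m|/forallPn[i /negPf ne_i]] :=
    boolP [forall i, m' i == m i].
  by case/eqP: ne_m; apply/mnmP => i; rewrite (eqP (eq_m i)).
by rewrite (bigD1 i) //= ne_i mul0r.
Qed.

(** The same [u] serves every variable, so a permutation only reindexes the product of
    coefficients. *)
Lemma msym_textend (s : 'S_n) u f : msym s (textend u f) = textend u (msym s f).
Proof.
apply: (@eq_linear_mpolyX _ (msym s \o textend u) (textend u \o msym s)) => m.
rewrite /= msymX !textendX.
apply/mpolyP => m'; rewrite mcoeff_sym !mcoeff_tensor.
rewrite [RHS](reindex_inj (@perm_inj _ s)) /=.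
by apply: eq_bigr => i _; rewrite !mnmE permK.
Qed.

Lemma sym_textend u f : f \is symmetric -> textend u f \is symmetric.
Proof. by move=> /issymP sf; apply/issymP => s; rewrite msym_textend sf. Qed.

End TensorPower.

(** * Homogeneous components, and one-variable computations over ['F_2] *)

Lemma mcoeff_pihomog (R : nzRingType) n d (f : {mpoly R[n]}) m :
  (pihomog mdeg d f)@_m = if mdeg m == d then f@_m else 0.
Proof.
rewrite [in RHS](mpolyE f) pihomogE !raddf_sum /= big_mkcond /=.
case: eqP => [md|/eqP md].
  apply: eq_bigr => m' _; case: eqP => // m'd; rewrite mcoeffZ mcoeffX.
  by case: eqP => [e|_]; [rewrite e in m'd | rewrite mulr0].
apply: big1 => m' _; case: eqP => // m'd; rewrite mcoeffZ mcoeffX.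
by case: eqP => [e|_]; [rewrite -e m'd eqxx in md | rewrite mulr0].
Qed.

Lemma sqr_F2 (a : 'F_2) : a ^+ 2 = a.
Proof. by case: a => [[|[|]]] // ?; apply: val_inj. Qed.

Lemma pchar2_poly : 2%N \in [pchar {poly 'F_2}].
Proof. by rewrite pchar_poly pchar_Fp. Qed.

Lemma poly_exprD_pow2 (p q : {poly 'F_2}) a :
  (p + q) ^+ (2 ^ a) = p ^+ (2 ^ a) + q ^+ (2 ^ a).
Proof. by rewrite exprDn_pchar // pnatX pnatE // pchar2_poly. Qed.

Lemma poly_sqr_F2 (p : {poly 'F_2}) : p ^+ 2 = p \Po 'X^2.
Proof.
elim/poly_ind: p => [|p c IHp]; first by rewrite comp_poly0 expr0n.
rewrite comp_poly_MXaddC -IHp (@poly_exprD_pow2 _ _ 1) exprMn.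
by rewrite -rmorphXn /= sqr_F2.
Qed.

Definition Sq_var : {poly 'F_2} := 'X + 'X^2.

Lemma coef_Sq_varX k j : (Sq_var ^+ k)`_j != 0 -> (k <= j)%N.
Proof.
rewrite /Sq_var -[X in X + _]mulr1 -mulrDr exprMn coefXnM.
by case: ltnP; rewrite ?eqxx.
Qed.

Lemma monic_Sq_var : Sq_var \is monic.
Proof.
by rewrite monicE /Sq_var lead_coefDr ?lead_coefXn // size_polyXn size_polyX.
Qed.

Lemma size_Sq_var : size Sq_var = 3.
Proof. by rewrite /Sq_var addrC size_polyDl size_polyXn ?size_polyX. Qed.

(** Over ['F_2] the derivative of a polynomial is the square of its odd part. As [Sq_var] has
    derivative 1, that of its [k]-th power is 0 for even [k] and the square of [Sq_var ^+ k./2] for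
    odd [k]. *)
Lemma odd_poly_Sq_var k :
  odd_poly (Sq_var ^+ k) = if odd k then Sq_var ^+ k./2 else 0.
Proof.
have deriv1 : Sq_var^`() = 1.
  rewrite /Sq_var derivD derivX derivXn /=.
  by rewrite (mulrn_pchar pchar2_poly) addr0.
have derivE : (Sq_var ^+ k)^`() = if odd k then (Sq_var ^+ k./2) ^+ 2 else 0.
  rewrite deriv_exp deriv1 mul1r -[X in _ *+ X]odd_double_half -muln2 mulrnDr.
  rewrite mulrnA (mulrn_pchar pchar2_poly) addr0.
  case k_odd: (odd k) => //; rewrite -exprM muln2 mulr1n; congr (_ ^+ _).
  by rewrite -[in LHS](odd_double_half k) k_odd.
apply/polyP => j; rewrite coef_odd_poly.
have -> : (Sq_var ^+ k)`_j.*2.+1 = (Sq_var ^+ k)^`()`_j.*2.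
  rewrite coef_deriv mulrS -mul2n mulrnA.
  by rewrite (mulrn_pchar (pchar_Fp _)) // mul0rn addr0.
rewrite derivE; case: ifP => _; last by rewrite !coef0.
by rewrite poly_sqr_F2 coef_comp_poly_Xn // -mul2n dvdn_mulr // mulKn.
Qed.

Definition down_var k : {poly 'F_2} := if odd k then 'X^(k./2) else 0.

Lemma uextend_down q : uextend down_var q = odd_poly q.
Proof.
apply/polyP => j; rewrite coef_odd_poly coef_sum.
pose k := maxn (size q) j.*2.+2; have lt_jk : (j.*2.+1 < k)%N.
  by rewrite leq_max leqnn orbT.
transitivity (uextend down_var q)`_j; first by rewrite coef_sum.
rewrite (@uextend_wide _ k) ?leq_maxl // coef_sum (bigD1 (Ordinal lt_jk)) //=.
rewrite /down_var /= odd_double /= uphalf_double coefZ coefXn eqxx mulr1.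
rewrite big1 ?addr0 // => i ne_i; rewrite coefZ; case: ifP => i_odd.
  rewrite coefXn; case: eqP => [ij|]; last by rewrite mulr0.
  by case/eqP: ne_i; apply: val_inj; rewrite /= -(odd_double_half i) i_odd ij.
by rewrite coef0 mulr0.
Qed.

Lemma uextend_Sq q : uextend (fun k => Sq_var ^+ k) q = q \Po Sq_var.
Proof. by rewrite comp_polyE. Qed.

(** * Truncated hit witnesses in one variable *)

(* [xi N] is the conjugate total square of [x], truncated so as to be a
   polynomial: substituting [x + x^2] for [x] gives back [x + x^(2^N)]. *)
Definition xi N : {poly 'F_2} := \sum_(a < N) 'X^(2 ^ a).

Lemma xi_Sq_var N : xi N \Po Sq_var = 'X + 'X^(2 ^ N).
Proof.
elim: N => [|N IHN].
  by rewrite /xi big_ord0 comp_poly0 expr1 (addrr_pchar2 pchar2_poly).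
rewrite /xi big_ord_recr comp_polyD -/(xi N) IHN comp_Xn_poly.
rewrite /Sq_var poly_exprD_pow2 -exprM -expnS addrA -(addrA 'X).
by rewrite (addrr_pchar2 pchar2_poly) addr0.
Qed.

(** One factor of [W]: substituting [Sq_var] turns [xi] back into ['X], up to truncation, and ['X^h]
    into a polynomial with leading term ['X^(2 * h)], so ['X^k] is recovered as leading term. *)
Definition hit_var N k : {poly 'F_2} := xi N ^+ odd k * 'X^(k./2).

Lemma coef_hit_var N k j : (hit_var N k)`_j != 0 ->
  exists a, j = (odd k * 2 ^ a + k./2)%N.
Proof.
rewrite coefMXn; case: ltnP => [|le_kj]; first by rewrite eqxx.
case k_odd: (odd k) => /=; last first.
  rewrite coef1 subn_eq0; case: leqP => [le_jk _|]; last by rewrite eqxx.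
  (* For even [k] the exponent [a] is multiplied by 0, so any value will do. *)
  by exists 0%N; apply/eqP; rewrite eqn_leq le_jk.
rewrite expr1 coef_sum => /eqP xi_neq0.
case: (boolP [exists a : 'I_N, ('X^(2 ^ a) : {poly 'F_2})`_(j - k./2) != 0]).
  case/existsP => a; rewrite coefXn.
  case: ((j - k./2)%N =P (2 ^ a)%N) => [ja _|_]; last by rewrite eqxx.
  by exists a; rewrite mul1n -ja subnK.
move/existsPn => xi0; case: xi_neq0; rewrite big1 // => a _.
exact/eqP/negPn/xi0.
Qed.

(** The truncation error is a multiple of ['X^(2 ^ N)], invisible in degrees below [2 ^ N]. *)
Lemma coef_hit_var_Sq N k j : (j < 2 ^ N)%N ->
  (hit_var N k \Po Sq_var)`_j = ('X ^+ odd k * Sq_var ^+ k./2)`_j.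
Proof.
move=> lt_jN; rewrite /hit_var comp_polyM comp_Xn_poly.
case: (odd k); last by rewrite !expr0 comp_polyC.
by rewrite !expr1 xi_Sq_var mulrDl coefD ['X^_ * _]mulrC coefMXn lt_jN addr0.
Qed.

Lemma monic_oddX_Sq_var k :
  'X ^+ odd k * Sq_var ^+ k./2 \is monic /\
  size ('X ^+ odd k * Sq_var ^+ k./2) = k.+1.
Proof.
have monicS : Sq_var ^+ k./2 \is monic by rewrite monic_exp ?monic_Sq_var.
split; first by rewrite monicMl ?monicXn.
rewrite size_monicM ?monicXn ?monic_neq0 // size_polyXn addSn /=.
have := size_exp Sq_var k./2; rewrite size_Sq_var mul2n.
move: (monic_neq0 monicS); rewrite -size_poly_gt0.
case: (size _) => // s _ /= ->.
by rewrite addnS odd_double_half.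
Qed.

Lemma coef_hit_var_Sq_gt N k j : (j < 2 ^ N)%N -> (k < j)%N ->
  (hit_var N k \Po Sq_var)`_j = 0.
Proof.
move=> lt_jN lt_kj; rewrite coef_hit_var_Sq // nth_default //.
by have [_ ->] := monic_oddX_Sq_var k.
Qed.

Lemma coef_hit_var_Sq_lead N k : (k < 2 ^ N)%N ->
  (hit_var N k \Po Sq_var)`_k = 1.
Proof.
move=> lt_kN; rewrite coef_hit_var_Sq //.
have [/monicP lead1 size1] := monic_oddX_Sq_var k.
by move: lead1; rewrite lead_coefE size1.
Qed.

(** * The total square, the Kameko maps and the witness in several variables *)

Section Operations.
Context (n : nat).
Local Notation P := {mpoly 'F_2[n]}.
Implicit Types (f g : P) (m : 'X_{1..n}).

Definition mnm_up m : 'X_{1..n} := [multinom (m i).*2.+1 | i < n].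

Lemma mdeg_up m : mdeg (mnm_up m) = (2 * mdeg m + n)%N.
Proof.
rewrite !mdegE big_distrr -[X in (_ + X)%N]card_ord -sum1_card -big_split.
by apply: eq_bigr => i _; rewrite mnmE /= -mul2n addn1.
Qed.

Lemma Sq_totalE f : Sq_total f = textend (fun k => Sq_var ^+ k) f.
Proof.
rewrite /Sq_total comp_mpolyEX; apply: eq_bigr => m _; congr (_ *: _).
rewrite comp_mpolyX; apply: eq_bigr => i _; rewrite tnth_mktuple.
rewrite rmorphXn horner_exp /Sq_var rmorphD /= map_polyX map_polyXn.
by rewrite hornerD hornerX hornerXn.
Qed.

Definition down f : P := textend down_var f.

HB.instance Definition _ := GRing.Linear.copy down (textend down_var).

Lemma mcoeff_down f m : (down f)@_m = f@_(mnm_up m).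
Proof.
rewrite /down /textend [in RHS](mpolyE f) !raddf_sum; apply: eq_bigr => m' _ /=.
rewrite !mcoeffZ mcoeff_tensor mcoeffX; congr (_ * _).
have [-> | /eqP ne_m] := m' =P mnm_up m.
  rewrite big1 // => i _; rewrite mnmE /down_var /= odd_double.
  by rewrite uphalf_double coefXn eqxx.
have [/forallP eq_m | /forallPn [i ne_i]] :=
    boolP [forall i, m' i == (m i).*2.+1].
  by case/eqP: ne_m; apply/mnmP => i; rewrite mnmE (eqP (eq_m i)).
rewrite (bigD1 i) //= /down_var.
case: ifP => i_odd; last by rewrite coef0 mul0r.
rewrite coefXn; case: eqP => [mi|_]; last by rewrite mul0r.
by rewrite mi -{1}(odd_double_half (m' i)) i_odd eqxx in ne_i.
Qed.

(** Squaring is additive in characteristic 2 and fixes the scalars of ['F_2]. *)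
Lemma kameko_is_linear : linear (@kameko n).
Proof.
move=> c f g; have P2 := rmorph_pchar (@mpolyC n _) (pchar_Fp (isT : prime 2)).
by rewrite /kameko exprDn_pchar ?pnatE // exprZn sqr_F2 mulrDr -scalerAr.
Qed.

HB.instance Definition _ :=
  GRing.isLinear.Build 'F_2 P P *:%R (@kameko n) kameko_is_linear.

Lemma kamekoX m : kameko 'X_[m] = 'X_[mnm_up m].
Proof.
rewrite /kameko mprodXE mpolyXn -mpolyXD; congr 'X_[_]; apply/mnmP => i.
rewrite mnmDE mulmnE mnmE mnm_sumE (bigD1 i) //= mnm1E eqxx big1 => [|j ne_j].
  by rewrite addn0 mulnC mul2n.
by rewrite mnm1E (negPf ne_j).
Qed.

Lemma kamekoE f : kameko f = textend (fun k => 'X^(k.*2.+1)) f.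
Proof.
move: f; apply: (eq_linear_mpolyX (L1 := @kameko n)) => m.
rewrite /= kamekoX textendX.
by rewrite -[LHS]textendXn textendX; apply: eq_bigr => i _; rewrite mnmE.
Qed.

Lemma kamekoK : cancel (@kameko n) down.
Proof.
move=> f; rewrite kamekoE /down textend_comp -[RHS]textendXn.
apply: eq_textend => k.
by rewrite uextendXn /down_var /= odd_double uphalf_double.
Qed.

(** In one variable, both sides send ['X^k] to the odd part of [Sq_var ^+ k], computed by
    [odd_poly_Sq_var]. *)
Lemma down_Sq_total f : down (Sq_total f) = Sq_total (down f).
Proof.
rewrite !Sq_totalE /down !textend_comp; apply: eq_textend => k.
rewrite uextend_down odd_poly_Sq_var uextend_Sq /down_var.
by case: ifP => _; rewrite ?comp_Xn_poly ?comp_poly0.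
Qed.

Lemma down_pihomog d f :
  down (pihomog mdeg (2 * d + n) f) = pihomog mdeg d (down f).
Proof.
apply/mpolyP => m; rewrite mcoeff_down 2!mcoeff_pihomog mcoeff_down mdeg_up.
by rewrite eqn_add2r eqn_pmul2l.
Qed.

Lemma down_homog d f : f \is (2 * d + n).-homog -> down f \is d.-homog.
Proof. by rewrite homog_piE => /eqP <-; rewrite down_pihomog pihomogP. Qed.

Lemma down_eq0 e f : f \is e.-homog -> (forall d, e <> (2 * d + n)%N) ->
  down f = 0.
Proof.
move=> fe ne_e; apply/mpolyP => m; rewrite mcoeff_down mcoeff0.
apply: (dhomog_nemf_coeff fe); apply/eqP => em.
by apply: (ne_e (mdeg m)); rewrite -mdeg_up.
Qed.

Lemma down0_even f m : down f = 0 -> m \in msupp f -> exists i, ~~ odd (m i).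
Proof.
move=> f0 mf; apply/existsP; rewrite -negb_forall; apply/negP => /forallP m_odd.
have m_up : m = mnm_up [multinom (m i)./2 | i < n].
  apply/mnmP => i; rewrite !mnmE -[LHS]odd_double_half.
  by rewrite m_odd.
by move: mf; rewrite mcoeff_msupp m_up -mcoeff_down f0 mcoeff0 eqxx.
Qed.

Lemma kameko_homog d f : f \is d.-homog -> kameko f \is (2 * d + n).-homog.
Proof.
move=> /dhomogP fd; rewrite (mpolyE f) linear_sum big_seq.
apply: rpred_sum => m /fd md; rewrite linearZ rpredZ //= kamekoX dhomogX /=.
by rewrite mdeg_up md.
Qed.

(** [Sq_var ^+ k] is divisible by ['X^k], so no exponent can drop. *)
Lemma pihomog_Sq_total_lt d e f : (d < e)%N -> f \is e.-homog ->
  pihomog mdeg d (Sq_total f) = 0.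
Proof.
move=> lt_de fe; apply/mpolyP => m; rewrite mcoeff_pihomog mcoeff0.
case: eqP => // md; rewrite Sq_totalE raddf_sum big_seq big1 //= => m' m'f.
have m'e : mdeg m' = e by exact: dhomog_mf fe m' m'f.
rewrite mcoeffZ mcoeff_tensor.
apply/eqP; rewrite mulf_eq0; apply/orP; right.
apply: contraTT lt_de => /prodf_neq0 nz; rewrite -leqNgt -md -m'e !mdegE.
by apply: leq_sum => i _; apply: coef_Sq_varX; apply: nz.
Qed.

(** For inhomogeneous [f], each component of degree [d - r] contributes its [Sq r], and components
    of degree above [d] contribute nothing. *)
Lemma sum_Sq d f :
  \sum_(r < d.+1) Sq r (pihomog mdeg (d - r) f) = pihomog mdeg d (Sq_total f).
Proof.
pose F e := pihomog mdeg d (Sq_total (pihomog mdeg e f)).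
transitivity (\sum_(e < d.+1) F e).
  rewrite (reindex_inj rev_ord_inj); apply: eq_bigr => e _ /=.
  have le_ed : (e <= d)%N by rewrite -ltnS.
  by rewrite subSS subKn // (Sq_homogE _ (pihomogP _ _ _)) subnKC.
pose k := maxn (msize f) d.+1.
have [le_fk le_dk] : (msize f <= k)%N /\ (d.+1 <= k)%N.
  by rewrite !leq_max !leqnn orbT.
rewrite Sq_totalE [X in textend _ X](pihomog_partitionE le_fk).
rewrite [X in pihomog _ _ X]raddf_sum [RHS]raddf_sum (big_ord_widen k F) //.
rewrite big_mkcond; apply: eq_bigr => e _ /=; rewrite /F -Sq_totalE.
case: ltnP => // lt_de; apply/esym.
exact: pihomog_Sq_total_lt lt_de (pihomogP _ _ _).
Qed.

Definition hit_witness N f : P := textend (hit_var N) f.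

(** On a monomial [m], the factor at [i] is ['X^(m i)] plus lower terms, as far as degrees up to [d]
    can see. Another monomial of the same degree exceeds [m] in some variable, where the factor has
    coefficient 0. *)
Lemma Sq_total_hit_witness N d f : (d < 2 ^ N)%N -> f \is d.-homog ->
  pihomog mdeg d (Sq_total (hit_witness N f)) = f.
Proof.
move=> lt_dN fd; rewrite Sq_totalE /hit_witness textend_comp.
under eq_textend do rewrite uextend_Sq.
rewrite [RHS]mpolyE linear_sum big_seq [RHS]big_seq; apply: eq_bigr => m mf /=.
have md : mdeg m = d by exact: dhomog_mf fd m mf.
rewrite linearZ; congr (_ *: _); apply/mpolyP => m'.
rewrite mcoeff_pihomog mcoeffX mcoeff_tensor.
have [m'd | ne_m'd] := eqVneq (mdeg m') d; last first.
  by case: eqP => // mm'; rewrite -mm' md eqxx in ne_m'd.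
have lt_N i : (m' i < 2 ^ N)%N.
  by apply: leq_ltn_trans lt_dN; rewrite -m'd mdegE (bigD1 i) //= leq_addr.
have [-> | ne_m] := eqVneq m m'.
  by apply: big1 => i _; rewrite coef_hit_var_Sq_lead.
(* Otherwise [m'] is bounded by [m] pointwise, and equality of the degrees forces equality of the
   exponents. *)
have [i lt_i] : exists i, (m i < m' i)%N.
  apply/existsP; rewrite -[[exists _, _]]negbK negb_exists; apply/negP.
  move/forallP => ge_m; case/eqP: ne_m; apply/mnmP => i; apply/eqP.
  have le_m j : (m' j <= m j ?= iff (m' j == m j))%N.
    by apply: leqif_eq; rewrite leqNgt ge_m.
  have [_] := leqif_sum (fun j (_ : true) => le_m j).
  by rewrite -!mdegE m'd md eqxx => /esym/forallP/(_ i); rewrite eq_sym.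
by rewrite (bigD1 i) //= coef_hit_var_Sq_gt ?mul0r.
Qed.

End Operations.

(** * Hits and the Kameko maps *)

Lemma mu_le (r : seq nat) :
  all (leq 1) r -> (mu (\sum_(k <- r) (2 ^ k - 1)) <= size r)%N.
Proof.
move=> r_gt0; rewrite /mu; case: ex_minnP => s _; apply.
by apply/asboolP; exists (in_tuple r).
Qed.

Section Hits.
Context (n : nat).
Local Notation P := {mpoly 'F_2[n]}.
Implicit Types (f g : P).

(* If [x^m'] occurs in the image of [x^m], then [2 m'_i - m_i] is [0] for even
   [m_i] and some [2^(a+1) - 1] for odd [m_i]; summing over [i] writes [D] with
   as many terms as [m] has odd exponents. *)
Lemma pihomog_hit_witness N d f : mu d = n -> f \is d.-homog -> down f = 0 ->
  pihomog mdeg d (hit_witness N f) = 0.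
Proof.
move=> mu_d fd f0; apply/mpolyP => m'; rewrite mcoeff_pihomog mcoeff0.
case: eqP => // m'd; rewrite /hit_witness /textend raddf_sum big_seq big1 //=.
move=> m mf; rewrite mcoeffZ mcoeff_tensor.
have md : mdeg m = d by exact: dhomog_mf fd m mf.
have [i0 i0_even] := down0_even f0 mf.
apply/eqP; rewrite mulf_eq0; apply/orP; right.
apply/negPn/negP => /prodf_neq0 nz.
have /fin_all_exists[a aP] :
    forall i, exists a, m' i = (odd (m i) * 2 ^ a + (m i)./2)%N.
  by move=> i; apply: (coef_hit_var (nz i isT)).
pose r := [seq (a i).+1 | i <- enum 'I_n & odd (m i)].
have r_gt0 : all (leq 1) r by apply/allP => _ /mapP[i _ ->].
(* The even exponent at [i0] is left out of [r]. *)
have lt_rn : (size r < n)%N.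
  rewrite size_map size_filter -[X in (_ < X)%N](size_enum_ord n).
  rewrite ltn_neqAle count_size andbT -all_count; apply/allPn.
  by exists i0; rewrite ?mem_enum.
have rE : (\sum_(k <- r) (2 ^ k - 1))%N = d.
  rewrite big_map big_filter big_enum_cond /= big_mkcond /=.
  (* Adding [mdeg m] on the left and [mdeg m'] on the right, both equal to [d], reduces the claim to
     a comparison with [2 * m' i] for each [i]. *)
  apply: (@addIn d); rewrite -{1}md mdegE -big_split addnn -mul2n -m'd mdegE.
  rewrite big_distrr; apply: eq_bigr => i _ /=.
  rewrite aP -{2}(odd_double_half (m i)) mulnDr mul2n.
  have := expn_gt0 2 (a i); case: (odd (m i)) => /=; rewrite ?expnS; lia.
by move: (mu_le r_gt0); rewrite rE mu_d leqNgt lt_rn.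
Qed.

(** Compare components in [down_Sq_total]: degree [2 * (e + s) + n] goes down to degree [e + s]. *)
Lemma down_Sq e s f : f \is (2 * e + n).-homog ->
  down (Sq (2 * s) f) = Sq s (down f).
Proof.
move=> fh; rewrite (Sq_homogE _ fh) (Sq_homogE _ (down_homog fh)).
by rewrite addnAC -mulnDr down_pihomog down_Sq_total.
Qed.

(** * Uniform treatment of hits in [P(n)] and in [B(n)] *)

Section Closed.
Context (M : submodClosed P).
Hypothesis textend_closed : forall u f, f \in M -> textend u f \in M.
Hypothesis pihomog_closed : forall e f, f \in M -> pihomog mdeg e f \in M.

Lemma Sq_closed r e f : f \in M -> f \is e.-homog -> Sq r f \in M.
Proof.
move=> fM fe; rewrite (Sq_homogE r fe) pihomog_closed //.
by rewrite Sq_totalE textend_closed.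
Qed.

Lemma hit0 d : hit M d 0.
Proof.
exists (fun=> 0); split=> [r _|]; first by rewrite !rpred0.
by rewrite big1 // => r _; rewrite linear0.
Qed.

Lemma hitD d f g : hit M d f -> hit M d g -> hit M d (f + g).
Proof.
move=> [u [uP ->]] [v [vP ->]]; exists (fun r => u r + v r); split=> [r r_d|].
  by have [[? ?] [? ?]] := (uP r r_d, vP r r_d); rewrite !rpredD.
by rewrite -big_split; apply: eq_bigr => r _; rewrite linearD.
Qed.

Lemma hit_sum d (I : Type) (s : seq I) (Q : pred I) (F : I -> P) :
  (forall i, Q i -> hit M d (F i)) -> hit M d (\sum_(i <- s | Q i) F i).
Proof. by apply: big_ind; [apply: hit0 | apply: hitD]. Qed.

Lemma hit_Sq d r g : (1 <= r <= d)%N -> g \in M -> g \is (d - r).-homog ->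
  hit M d (Sq r g).
Proof.
move=> /andP[r_gt0 le_rd] gM gd; exists (fun s => if s == r then g else 0).
split=> [s _|]; first by case: eqP => [->|_]; rewrite ?rpred0.
rewrite (big_nat_widenl _ 0) // big_mkord.
have lt_rd : (r < d.+1)%N by [].
rewrite (bigD1 (Ordinal lt_rd)) //= eqxx big1 ?addr0 // => s /andP[_ ne_s].
by rewrite ifN ?linear0 // -val_eqE.
Qed.

(** Expand [f] by [sum_Sq] applied to its witness, with [N = d]. The term [r = 0] vanishes by
    [pihomog_hit_witness], and the remaining terms are hits. *)
Lemma hit_down0 d f : mu d = n -> f \in M -> f \is d.-homog -> down f = 0 ->
  hit M d f.
Proof.
move=> mu_d fM fd f0; have lt_d : (d < 2 ^ d)%N by exact: ltn_expl.
rewrite -(Sq_total_hit_witness lt_d fd) -sum_Sq big_ord_recl subn0.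
rewrite pihomog_hit_witness // linear0 add0r.
apply: hit_sum => i _; apply: hit_Sq; first by rewrite lift0 /=.
  exact/pihomog_closed/textend_closed.
exact: pihomogP.
Qed.

Lemma kameko_closed f : f \in M -> kameko f \in M.
Proof. by rewrite kamekoE; apply: textend_closed. Qed.

Lemma down_closed f : f \in M -> down f \in M.
Proof. exact: textend_closed. Qed.

(** Each [Sq r (g r)] either goes to [Sq (d - e)] of [down (g r)], when [g r] has degree
    [2 * e + n], or is killed. *)
Lemma hit_down d f : hit M (2 * d + n) f -> hit M d (down f).
Proof.
case=> g [gP ->]; rewrite linear_sum big_nat_cond; apply: hit_sum => r.
rewrite /= andbT ltnS => r_D.
have [gM gh] := gP r r_D; have /andP[r_gt0 le_rD] := r_D.
have [[e eE]|ne_e] :=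
    pselect (exists e, (2 * d + n - r = 2 * e + n)%N); last first.
  (* The degree of [g r] is below [n] or differs from [n] in parity, so [down (g r)] is 0. *)
  rewrite (Sq_homogE r gh) subnK // down_pihomog down_Sq_total.
  rewrite (down_eq0 gh) => [|e eE]; last by apply: ne_e; exists e.
  by rewrite Sq_totalE !linear0; apply: hit0.
have [rE s_bd] : r = (2 * (d - e))%N /\ (1 <= d - e <= d)%N by lia.
rewrite eE in gh; have -> : Sq r (g r) = Sq (2 * (d - e)) (g r) by rewrite -rE.
rewrite (down_Sq _ gh); apply: hit_Sq => //.
  exact: down_closed.
have -> : (d - (d - e) = e)%N by lia.
exact: down_homog.
Qed.

(** The up map need not carry [Sq r] to [Sq (2 * r)], but the discrepancy is killed by [down], hence
    is hit by [hit_down0]. *)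
Lemma hit_kameko d f : mu (2 * d + n) = n -> hit M d f ->
  hit M (2 * d + n) (kameko f).
Proof.
move=> mu_D [g [gP ->]]; rewrite linear_sum big_nat_cond; apply: hit_sum => r.
rewrite /= andbT ltnS => r_d.
have [gM gh] := gP r r_d; have /andP[r_gt0 le_rd] := r_d.
have kh := kameko_homog gh; have kM := kameko_closed gM.
have r2_D : (1 <= 2 * r <= 2 * d + n)%N by lia.
have kh2 : kameko (g r) \is (2 * d + n - 2 * r).-homog.
  by have -> : (2 * d + n - 2 * r = 2 * (d - r) + n)%N by lia.
rewrite -[kameko _](subrK (Sq (2 * r) (kameko (g r)))).
apply: hitD; last exact: hit_Sq.
apply: hit_down0 => //.
- rewrite -scaleN1r rpredD ?rpredZ ?(Sq_closed _ kM kh) //.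
  exact/kameko_closed/(Sq_closed _ gM gh).
- apply: rpredB; last by rewrite (Sq_homogE _ kh2) subnK ?pihomogP //; lia.
  by apply: kameko_homog; rewrite (Sq_homogE _ gh) subnK // pihomogP.
- by rewrite linearB /= kamekoK (down_Sq _ kh) kamekoK subrr.
Qed.

End Closed.

End Hits.

(** * The induced isomorphism of relative cohits *)

Lemma cohit_classP n (M : submodClosed {mpoly 'F_2[n]}) d (f g : grade M d) :
  cohit_class f = cohit_class g <-> hit M d (val f - val g).
Proof.
rewrite -(raddfB val) /cohit_class; split => [/eqP|fg].
  by rewrite eq_lclass => /asboolP.
by apply/eqP; rewrite eq_lclass; apply/asboolP.
Qed.

Section RelativeKameko.
Context (n d : nat) (mu_D : mu (2 * d + n) = n).
Local Notation P := {mpoly 'F_2[n]}.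
Local Notation Pn := (@all_pred n : submodClosed P).
Local Notation Bn := (@sym_pred n : submodClosed P).
Local Notation D := (2 * d + n)%N.

Lemma hitP_kameko (f : P) : hit Pn d f -> hit Pn D (kameko f).
Proof. exact: hit_kameko. Qed.

Lemma hitB_kameko (f : P) : hit Bn d f -> hit Bn D (kameko f).
Proof.
apply: hit_kameko => // [u g|e g].
- exact: sym_textend.
- exact: pihomog_sym.
Qed.

Lemma hitP_down (f : P) : hit Pn D f -> hit Pn d (down f).
Proof. exact: hit_down. Qed.

Lemma hitB_down (f : P) : hit Bn D f -> hit Bn d (down f).
Proof. by apply: hit_down => u g; apply: sym_textend. Qed.

Fact down_gradeB (f : gradeB n D) : down (val f) \in grade_pred Bn d.
Proof.
apply/andP; split; first exact/sym_textend/gradeB_sym.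
exact/down_homog/gradeB_homog.
Qed.

Definition downB (f : gradeB n D) : gradeB n d := Grade (down_gradeB f).

Lemma kameko_class (f g : gradeB n d) : cohit_class f = cohit_class g ->
  cohit_class (kamekoB f) = cohit_class (kamekoB g).
Proof.
by move=> /cohit_classP/hitB_kameko; rewrite linearB => fg; apply/cohit_classP.
Qed.

Lemma down_class (f g : gradeB n D) : cohit_class f = cohit_class g ->
  cohit_class (downB f) = cohit_class (downB g).
Proof.
by move=> /cohit_classP/hitB_down; rewrite linearB => fg; apply/cohit_classP.
Qed.

Lemma kamekoBK (f : gradeB n d) : downB (kamekoB f) = f.
Proof. by apply: val_inj; apply: kamekoK. Qed.

(** Going down and up again changes [f] by a form killed by [down], which is a hit in [B(n)]. *)
Lemma downBK (f : gradeB n D) :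
  cohit_class (kamekoB (downB f)) = cohit_class f.
Proof.
apply/cohit_classP; apply: hit_down0 => //.
- by move=> u g; apply: sym_textend.
- by move=> e g; apply: pihomog_sym.
- apply: rpredB; last exact: gradeB_sym.
  exact: gradeB_sym (kamekoB (downB f)).
- apply: rpredB; last exact: gradeB_homog.
  exact: gradeB_homog (kamekoB (downB f)).
- by rewrite linearB /= kamekoK subrr.
Qed.

Lemma hitP_lrepr e (x : rel_cohit n e) :
  hit Pn e (val (lrepr (cohit_of_rel x) : gradeB n e)).
Proof. by apply/rel_predP; rewrite /cohit_class lreprK; apply: valP. Qed.

(** A representative of [x] is hit in [P(n)], and the up map preserves such hits. *)
Fact upsilon_rel_subproof (x : rel_cohit n d) :
  cohit_class (kamekoB (lrepr (cohit_of_rel x))) \in @rel_pred n D.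
Proof. by apply/rel_predP/hitP_kameko/hitP_lrepr. Qed.

Definition upsilon_rel x := RelCohit (upsilon_rel_subproof x).

(** Independence of the representative chosen by [lrepr], since the up map preserves hits in
    [B(n)]. *)
Lemma upsilon_relE (x : rel_cohit n d) (f : gradeB n d) :
  cohit_of_rel x = cohit_class f ->
  cohit_of_rel (upsilon_rel x) = cohit_class (kamekoB f).
Proof. by move=> xf; apply: kameko_class; rewrite /cohit_class lreprK. Qed.

Lemma upsilon_rel_is_linear : linear upsilon_rel.
Proof.
move=> a x y; apply: val_inj.
pose u : gradeB n d := lrepr (cohit_of_rel x).
pose v : gradeB n d := lrepr (cohit_of_rel y).
have xyE : cohit_of_rel (a *: x + y) = cohit_class (a *: u + v).
  by rewrite /cohit_class linearP /= !lreprK.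
apply: (etrans (upsilon_relE xyE)).
transitivity (cohit_class (a *: kamekoB u + kamekoB v)).
  by congr cohit_class; apply: val_inj; rewrite /= linearP.
by rewrite /cohit_class linearP.
Qed.

HB.instance Definition _ := GRing.isLinear.Build 'F_2 (rel_cohit n d)
  (rel_cohit n D) *:%R upsilon_rel upsilon_rel_is_linear.

Fact down_rel_subproof (y : rel_cohit n D) :
  cohit_class (downB (lrepr (cohit_of_rel y))) \in @rel_pred n d.
Proof. by apply/rel_predP/hitP_down/hitP_lrepr. Qed.

Definition down_rel y := RelCohit (down_rel_subproof y).

(** The inverse is [down_rel]: one composite is the identity already on forms, the other only modulo
    hits in [B(n)]. *)
Lemma upsilon_rel_bij : bijective upsilon_rel.
Proof.
exists down_rel => [x|y]; apply: val_inj => /=.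
  rewrite -[RHS]lreprK -[in RHS](kamekoBK (lrepr _)).
  by apply: down_class; rewrite /cohit_class lreprK.
rewrite -[RHS]lreprK -[RHS]downBK.
by apply: kameko_class; rewrite /cohit_class lreprK.
Qed.

End RelativeKameko.

Theorem proposition7p2 (n d : nat) (n_gt0 : (1 <= n)%N)
    (mu_D : mu (2 * d + n) = n) :
  exists upsilon_rel : {linear rel_cohit n d -> rel_cohit n (2 * d + n)},
    bijective upsilon_rel /\
    (forall (x : rel_cohit n d) (f : gradeB n d),
       cohit_of_rel x = cohit_class f ->
       cohit_of_rel (upsilon_rel x) = cohit_class (kamekoB f)).
Proof.
exists (upsilon_rel mu_D); split; first exact: upsilon_rel_bij.
exact: upsilon_relE.
Qed.
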